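(* Let $n\ge 2$ be an even integer, and let $g(n)$ be the probability that every person is matched at a circular table with $n$ people whose preferences are drawn uniformly at random from $\Pi_n=\{L,R\}^n$ (as defined in the context). Then $$g(n)=\frac{3^{n/2}-1}{2^{n-1}}.$$
   Context: People at the table are labeled $0,1,\dots,n-1$, with arithmetic on labels modulo $n$. Person $i$ has left neighbor $i-1$ and right neighbor $i+1$. A matching is a function $\mu:\{0,\dots,n-1\}\to\{0,\dots,n-1\}$ such that $\mu(i)\in\{i-1,i,i+1\}$ for all $i$, and $\mu(i)=j$ implies $\mu(j)=i$. Person $i$ is unmatched in $\mu$ if $\mu(i)=i$, and matched otherwise. Preferences are strings $\pi=\pi_0\pi_1\cdots\pi_{n-1}\in\Pi_n:=\{L,R\}^n$. If $\pi_i=L$, person $i$ strictly prefers $i-1$ to $i+1$; if $\pi_i=R$, person $i$ strictly prefers $i+1$ to $i-1$. In both cases $i$ strictly prefers being matched to either neighbor over being unmatched. (When $n=2$ the two neighbors coincide, and a person simply prefers being matched to the other person over being unmatched.) A matching $\mu$ is stable under $\pi$ if there is no blocking pair, i.e. no two neighbors $i$ and $i+1$ such that $\mu(i)\ne i+1$ and both strictly prefer each other to their current match (or to being unmatched, if they are unmatched). A string $\pi$ is regular if it contains at least one $L$ and at least one $R$, and irregular otherwise (all $L$'s or all $R$'s). For regular $\pi$ there is a unique stable matching, denoted $\mu_\pi$. For irregular $\pi$ with $n$ even, a matching is stable if and only if no person is unmatched. Definition of $g(n)$ for $n$ even: draw $\pi\in\Pi_n$ uniformly at random. If $\pi$ is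 regular, everyone is matched if and only if $\mu_\pi(i)\neq i$ for all $i$. If $\pi$ is irregular, everyone is considered matched. Then $g(n)$ is the probability that everyone is matched. *)

(* Defs.v *)
From HB Require Import structures.
From mathcomp Require Import all_boot all_order all_algebra.

Set Implicit Arguments.
Unset Strict Implicit.
Unset Printing Implicit Defensive.

Import Order.TTheory GRing.Theory Num.Theory.

Inductive dir := L | R.

Definition dir_isR (d : dir) : bool := if d is R then true else false.
Definition dir_of_bool (b : bool) : dir := if b then R else L.
Lemma dir_isRK : cancel dir_isR dir_of_bool. Proof. by case. Qed.
HB.instance Definition _ := Finite.copy dir (can_type dir_isRK).

(* Preference strings and seats: the neighbours of i : 'I_n are the cyclic    *)
(* predecessor ord_pred i (left) and the cyclic successor ordS i (right).     *)
Definition prefs (n : nat) : finType := {ffun 'I_n -> dir}.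

Definition is_matching (n : nat) (mu : {ffun 'I_n -> 'I_n}) : bool :=
  [forall i, mu i \in [:: ord_pred i; i; ordS i]]
  && [forall i, forall j, (mu i == j) ==> (mu j == i)].

Definition favorite (n : nat) (pi : prefs n) (i : 'I_n) : 'I_n :=
  if pi i is L then ord_pred i else ordS i.

Definition second_choice (n : nat) (pi : prefs n) (i : 'I_n) : 'I_n :=
  if pi i is L then ordS i else ord_pred i.

(* How much i likes the outcome j, where j = i means being unmatched. For     *)
(* n = 2 the two neighbours coincide, and the first test decides.             *)
Definition rank (n : nat) (pi : prefs n) (i j : 'I_n) : nat :=
  if j == favorite pi i then 2
  else if j == second_choice pi i then 1
  else 0.

Definition prefers (n : nat) (pi : prefs n) (i j k : 'I_n) : bool :=
  rank pi i k < rank pi i j.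

Definition blocking (n : nat) (pi : prefs n) (mu : {ffun 'I_n -> 'I_n})
    (i : 'I_n) : bool :=
  [&& mu i != ordS i,
      prefers pi i (ordS i) (mu i)
    & prefers pi (ordS i) i (mu (ordS i))].

Definition stable (n : nat) (pi : prefs n) (mu : {ffun 'I_n -> 'I_n}) : bool :=
  is_matching mu && [forall i, ~~ blocking pi mu i].

Definition regular (n : nat) (pi : prefs n) : bool :=
  [exists i, pi i == L] && [exists i, pi i == R].

(* The unique stable matching of a regular pi, by definite description:       *)
(* unset1 A is Some x when A = [set x]. The default (nobody matched) is used  *)
(* only when pi does not have exactly one stable matching.                    *)
Definition stable_matching (n : nat) (pi : prefs n) : {ffun 'I_n -> 'I_n} :=
  odflt [ffun i => i] (unset1 [set mu | stable pi mu]).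

Definition everyone_matched (n : nat) (pi : prefs n) : bool :=
  if regular pi then [forall i, stable_matching pi i != i] else true.

(* Probability under the uniform distribution on preference strings; the      *)
(* convention for irregular strings is meant for even n.                      *)
Definition g (n : nat) : rat :=
  (#|[set pi : prefs n | everyone_matched pi]|%:R / #|prefs n|%:R)%R.

(* Main.v *)
(** Call i a couple when i and i+1 are each other's favourite neighbour, i.e.
    pi_i pi_(i+1) = RL.  A couple is matched in every stable matching, and a
    matching leaving nobody out alternates around the table, so if everyone is
    matched then all couples have the same parity.  Conversely, if all couples
    have parity b, then pairing every i of parity b with i+1 is the only stable
    matching of a regular pi: a pair which is not matched cannot block, and this
    forces the same defect on the pair two seats further, hence all around the
    table, which makes pi irregular.
    Avoiding couples of a given parity means choosing each of n/2 disjoint pairs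
    of letters different from RL, in 3^(n/2) ways, and only the two irregular
    strings avoid all couples. *)
Require Import Defs.
From HB Require Import structures.
From mathcomp Require Import all_boot all_order all_algebra.
From mathcomp Require Import zify.

Set Implicit Arguments.
Unset Strict Implicit.
Unset Printing Implicit Defensive.

Import Order.TTheory GRing.Theory Num.Theory.
Local Open Scope ring_scope.

(** * Induction around the table and parity of seats *)

Lemma ordS_ind n (P : 'I_n -> Prop) :
  (forall j, P j -> P (ordS j)) -> forall i j, P i -> P j.
Proof.
move=> PS i j Pi.
have val_iter k : val (iter k (@ordS n) i) = ((i + k) %% n)%N.
  elim: k => [|k IHk]; first by rewrite addn0 modn_small.
  by rewrite iterS /= -[nat_of_ord _]/(val _) IHk addnS -addn1 modnDml addn1.
(* Adding [n - i + j] to [i] gives [n + j]; the subtraction is not truncated because [i < n]. *)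
suff -> : j = iter (n - i + j) (@ordS n) i.
  by elim: (n - i + j)%N => //= k; exact: PS.
apply: val_inj; rewrite val_iter addnA subnKC ?(ltnW (ltn_ord i)) //.
by rewrite modnDl modn_small.
Qed.


Lemma ord_pred_ind n (P : 'I_n -> Prop) :
  (forall j, P j -> P (ord_pred j)) -> forall i j, P i -> P j.
Proof.
(* Forward induction from [j] to [i] on [P k -> P j], which is trivial at [k = j]. *)
move=> PP i j; apply: (@ordS_ind n (fun k => P k -> P j) _ j i) => // k Pk PSk.
by apply: Pk; rewrite -(ordSK k); apply: PP.
Qed.

Lemma odd_ordS n b (i : 'I_n) : ~~ odd n -> (odd (ordS i) == b) = (odd i != b).
Proof.
by move=> /negbTE n_even; rewrite /= odd_mod //=; case: odd b => [] [].
Qed.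

Lemma odd_ord_pred n b (i : 'I_n) :
  ~~ odd n -> (odd (ord_pred i) == b) = (odd i != b).
Proof. by move=> n_even; rewrite -{2}(ord_predK i) odd_ordS // negbK. Qed.

Lemma dir_neqL (d : dir) : (d != L) = (d == R).
Proof. by case: d. Qed.

Lemma dir_neqR (d : dir) : (d != R) = (d == L).
Proof. by case: d. Qed.

(** * Couples, pairings and preferences *)

Definition couple {n} (pi : prefs n) (i : 'I_n) : bool :=
  (pi i == R) && (pi (ordS i) == L).

Definition pairing n (b : bool) : {ffun 'I_n -> 'I_n} :=
  [ffun i : 'I_n => if odd i == b then ordS i else ord_pred i].

Lemma matching_invol {n} {mu : {ffun 'I_n -> 'I_n}} :
  is_matching mu -> involutive mu.
Proof.
move=> /andP[_ /forallP H] i; apply/eqP.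
by have /forallP/(_ (mu i)) := H i; rewrite eqxx.
Qed.

Lemma matching_range {n} {mu : {ffun 'I_n -> 'I_n}} i :
  is_matching mu -> [\/ mu i = ord_pred i, mu i = i | mu i = ordS i].
Proof.
move=> /andP[/forallP/(_ i)]; rewrite !inE => /or3P[] /eqP-> _;
  by [constructor 1|constructor 2|constructor 3].
Qed.

(** The right neighbour beats every other outcome except a favourite on the left. The last clause
    matters for two seats, where both neighbours coincide. *)
Lemma prefers_ordS n (pi : prefs n) (i j : 'I_n) : j <> ordS i ->
  ~~ prefers pi i (ordS i) j ->
  [/\ pi i = L, j = ord_pred i & ord_pred i <> ordS i].
Proof.
move=> /eqP/negbTE jS; rewrite /prefers /rank /favorite /second_choice -leqNgt.
case: (pi i); rewrite ?eqxx ?jS.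
  case: (eqVneq (ordS i) (ord_pred i)) => [<-|]; first by rewrite jS.
  by move=> /eqP SP; case: eqP => [->|//] _; split=> // /esym.
by case: ifP.
Qed.

Lemma prefers_ord_pred n (pi : prefs n) (i j : 'I_n) : j <> ord_pred i ->
  ~~ prefers pi i (ord_pred i) j ->
  [/\ pi i = R, j = ordS i & ordS i <> ord_pred i].
Proof.
move=> /eqP/negbTE jP; rewrite /prefers /rank /favorite /second_choice -leqNgt.
case: (pi i); rewrite ?eqxx ?jP.
  by case: ifP.
case: (eqVneq (ord_pred i) (ordS i)) => [<-|]; first by rewrite jP.
by move=> /eqP PS; case: eqP => [->|//] _; split=> // /esym.
Qed.

(** * Local structure of a stable matching *)

Section Stable.

Context {n : nat} { pi : prefs n} {mu : {ffun 'I_n -> 'I_n}}.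
Context (mu_stable : stable pi mu).

Let muM : is_matching mu. Proof. by case/andP: mu_stable. Qed.
Let muK : involutive mu := matching_invol muM.

(** Here and in [right_defect]: the two reasons why the unmatched pair [i], [ordS i] does not block,
    one member being matched to a favourite on the far side. The last clauses ensure that this far
    side lies outside the pair. *)
Definition left_defect (i : 'I_n) :=
  [/\ pi i = L, mu i = ord_pred i & ord_pred i <> ordS i].

Definition right_defect (i : 'I_n) :=
  [/\ pi (ordS i) = R, mu (ordS i) = ordS (ordS i) & ordS (ordS i) <> i].

Lemma stable_defect i : mu i <> ordS i -> left_defect i \/ right_defect i.
Proof.
move=> muS; have muS' : mu (ordS i) <> ord_pred (ordS i).
  by rewrite ordSK => /(congr1 mu); rewrite muK => /esym.
have /andP[_ /forallP/(_ i)] := mu_stable.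
rewrite /blocking; move/eqP: (muS) => -> /=; rewrite negb_and => /orP[].
  by move/(prefers_ordS muS); left.
rewrite -{2}(ordSK i) => /(prefers_ord_pred muS')[piR eq_mu SP].
by right; split=> //; rewrite -{2}(ordSK i).
Qed.

(** Either defect contradicts one of the two letters of a couple. *)
Lemma stable_couple i : couple pi i -> mu i = ordS i.
Proof.
move=> /andP[/eqP piR /eqP piL].
by case: (eqVneq (mu i) (ordS i)) => // /eqP /stable_defect[[]|[]]; congruence.
Qed.

(** Seat [i] takes [i-1], so [i-2] and [i-1] are not matched together. Without a couple at [i-1] its
    letter is [L], which rules out a right defect of that pair. *)
Lemma left_defect_step i : left_defect i -> ~~ couple pi (ord_pred i) ->
  pi (ord_pred i) = L /\ left_defect (ord_pred (ord_pred i)).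
Proof.
move=> [piL mui PS]; rewrite /couple ord_predK piL eqxx andbT dir_neqR.
move=> /eqP piPL; split=> //; set k := ord_pred (ord_pred i).
have Sk : ordS k = ord_pred i by rewrite ord_predK.
case: (@stable_defect k) => [|//|[]]; last by rewrite Sk piPL.
rewrite Sk -mui => /(congr1 mu); rewrite !muK => ik; apply: PS.
by rewrite -Sk; congr ordS.
Qed.

Lemma right_defect_step i : right_defect i -> ~~ couple pi (ordS i) ->
  pi (ordS (ordS i)) = R /\ right_defect (ordS (ordS i)).
Proof.
move=> [piR muS SS]; rewrite /couple piR eqxx dir_neqL => /eqP piSR.
split=> //; case: (@stable_defect (ordS (ordS i))) => [|[]|//]; last first.
  by rewrite piSR.
by rewrite -{1}muS muK => /ordS_inj/esym.
Qed.

End Stable.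

Arguments left_defect {n} pi mu i.
Arguments right_defect {n} pi mu i.

(** * Strings whose couples share a parity *)

Definition one_parity n (b : bool) (pi : prefs n) : bool :=
  [forall i, couple pi i ==> (odd i == b)].

(** An unmatched pair can only start at the parity without couples, so one member prefers the far
    side, and that is where [pairing] matches it. *)
Lemma pairing_stable n b (pi : prefs n) : ~~ odd n ->
  one_parity b pi -> stable pi (pairing n b).
Proof.
move=> n_even /forallP pib; apply/andP; split.
  apply/andP; split; apply/forallP => i.
    by rewrite ffunE; case: ifP; rewrite !inE eqxx ?orbT.
  apply/forallP => j; apply/implyP => /eqP <-; apply/eqP; rewrite !ffunE.
  by case: (boolP (odd i == b)) => ib;
    rewrite ?odd_ordS ?odd_ord_pred // ib ?ordSK ?ord_predK.
apply/forallP => i; apply/negP => /and3P[muS].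
have ib : odd i != b by apply: contraNneq muS => ib; rewrite ffunE ib eqxx.
move: (pib i); rewrite (negbTE ib) implybF negb_and !ffunE (negbTE ib).
rewrite odd_ordS // ib dir_neqR dir_neqL /prefers /rank /favorite /second_choice.
by move=> /orP[] /eqP->; rewrite ?ordSK !eqxx ?ltnS; do ?case: ifP.
Qed.

Lemma stable_pairing n b (pi : prefs n) mu : ~~ odd n -> regular pi ->
  one_parity b pi -> stable pi mu -> mu = pairing n b.
Proof.
move=> n_even /andP[/existsP[l /eqP piL] /existsP[r /eqP piR]].
move=> /forallP pib mu_st.
have pibN (i : 'I_n) : odd i != b -> ~~ couple pi i.
  by move=> ib; apply: contraNN ib; exact/implyP.
have muM : is_matching mu by case/andP: mu_st.
have muS (i : 'I_n) : odd i == b -> mu i = ordS i.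
  move=> ib; case: (eqVneq (mu i) (ordS i)) => // /eqP /(stable_defect mu_st).
  case=> [Di|Di].
    (* Defects travel by two seats, so [E] keeps the one at whichever of [k] and [ord_pred k] has
       parity [b]. Walking left carries the letter [L] as far as [r]. *)
    pose E k := [/\ pi k = L, odd k == b -> left_defect pi mu k
                  & odd k != b -> left_defect pi mu (ord_pred k)].
    suff [] : E r by rewrite piR.
    apply: (@ord_pred_ind n E _ i r); last first.
      by split; rewrite ?ib //; case: Di.
    move=> k [piL' Dk DPk]; rewrite /E odd_ord_pred //.
    case: (boolP (odd k == b)) => kb.
      have [|//] := left_defect_step mu_st (Dk kb).
      by apply: pibN; rewrite odd_ord_pred // kb.
    by have Dk' := DPk kb; have [piPL _ _] := Dk'.
  (* The mirror walk carries [R] to the right; it tracks the letter of [ordS k], hence the target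
     [ord_pred l]. *)
  pose E k := [/\ pi (ordS k) = R, odd k == b -> right_defect pi mu k
                & odd k != b -> right_defect pi mu (ordS k)].
  suff [] : E (ord_pred l) by rewrite ord_predK piL.
  apply: (@ordS_ind n E _ i (ord_pred l)); last first.
    by split; rewrite ?ib //; case: Di.
  move=> k [piR' Dk DSk]; rewrite /E odd_ordS //.
  case: (boolP (odd k == b)) => kb.
    have [|//] := right_defect_step mu_st (Dk kb).
    by apply: pibN; rewrite odd_ordS // kb.
  by have Dk' := DSk kb; have [piSR _ _] := Dk'.
apply/ffunP => i; rewrite ffunE; case: ifPn => [/muS //|ib].
have Pb : odd (ord_pred i) == b by rewrite odd_ord_pred.
by rewrite -{1}[i]ord_predK -(muS _ Pb) (matching_invol muM).
Qed.

(** With nobody left out, a seat not taken by its left neighbour must go right, so one pair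
    determines all the others. *)
Lemma perfect_pairing n b (mu : {ffun 'I_n -> 'I_n}) (i : 'I_n) : ~~ odd n ->
  is_matching mu -> (forall j, mu j <> j) -> odd i == b -> mu i = ordS i ->
  mu = pairing n b.
Proof.
move=> n_even muM mu_nfix ib mui; apply/ffunP => j; rewrite ffunE.
pose E k := mu k = if odd k == b then ordS k else ord_pred k.
apply: (@ordS_ind n E _ i j); last by rewrite /E ib.
move=> {ib mui j} {}i; rewrite /E odd_ordS // ordSK.
case: (boolP (odd i == b)) => ib muE /=.
  by rewrite -muE (matching_invol muM).
case: (matching_range (ordS i) muM) => // [|/mu_nfix//]; rewrite ordSK => muS.
(* As [i] is matched to the left, [ordS i] can be matched to [i] only if both neighbours of [i]
   coincide; then the two descriptions of the partner agree. *)
have SP : ordS i = ord_pred i by rewrite -muE -{2}muS (matching_invol muM).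
by rewrite muS SP ord_predK.
Qed.

(** Reading rightwards from an [R], the letter can change only at a couple. *)
Lemma regular_couple n (pi : prefs n) : regular pi = [exists i, couple pi i].
Proof.
apply/idP/existsP => [|[i /andP[piR piL]]]; last first.
  by apply/andP; split; apply/existsP; [exists (ordS i)|exists i].
move=> /andP[/existsP[l /eqP piL] /existsP[r /eqP piR]].
apply/existsP; apply: contraT => /existsPn nc.
suff : pi l = R by rewrite piL.
apply: (@ordS_ind n (fun k => pi k = R) _ r l) => // k piRk.
by apply/eqP; rewrite -dir_neqL; move: (nc k); rewrite /couple piRk eqxx.
Qed.

Lemma everyone_matchedE n (pi : prefs n) : ~~ odd n ->
  everyone_matched pi = one_parity true pi || one_parity false pi.
Proof.
move=> n_even; rewrite /everyone_matched.
case: ifPn => [pi_reg|]; last first.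
  rewrite regular_couple => /existsPn nc; apply/esym/orP; left.
  by apply/forallP => i; rewrite (negbTE (nc i)).
apply/idP/idP => [/forallP nfix|]; last first.
  have paired b : one_parity b pi -> [forall i, stable_matching pi i != i].
    move=> pib; rewrite /stable_matching.
    have -> : [set mu | stable pi mu] = [set pairing n b].
      apply/setP => mu; rewrite !inE; apply/idP/eqP => [|->].
        exact: stable_pairing.
      exact: pairing_stable.
    rewrite set1K /=; apply/forallP => i.
    apply/eqP => /(congr1 (fun j : 'I_n => odd j)).
    rewrite ffunE; case: ifP => _ /eqP;
      by rewrite ?odd_ordS ?odd_ord_pred // eqxx.
  by case/orP; exact: paired.
move: nfix; rewrite /stable_matching.
(* The default matching fixes every seat, so if everyone is matched there is exactly one stable
   matching. *)
case set1E: unset1 => [mu|] /= nfix; last first.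
  by case/andP: pi_reg => /existsP[i _] _; have := nfix i; rewrite ffunE eqxx.
have mu_st : stable pi mu.
  have := unset1K [set mu | stable pi mu]; rewrite set1E /= => /setP/(_ mu).
  by rewrite !inE eqxx.
have muM : is_matching mu by case/andP: mu_st.
apply: contraT; rewrite negb_or => /andP[].
move=> /forallPn[i]; rewrite negb_imply => /andP[ci io].
move=> /forallPn[j]; rewrite negb_imply => /andP[cj je].
have {}io : odd i == false by case: odd io.
have {}je : odd j == true by case: odd je.
have nfix' (k : 'I_n) : mu k <> k by apply/eqP.
have muF := perfect_pairing n_even muM nfix' io (stable_couple mu_st ci).
have muT := perfect_pairing n_even muM nfix' je (stable_couple mu_st cj).
(* Equality of both pairings makes left and right neighbours coincide, so [i] and [ordS i] are the
   only seats; [j] is excluded from the first by parity and from the second by its letter. *)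
have SP (k : 'I_n) : ordS k = ord_pred k.
  have := congr1 (fun m : {ffun 'I_n -> 'I_n} => m k) muT.
  by rewrite {1}muF !ffunE; case: odd.
have /orP[/eqP ji|/eqP ji] : (j == i) || (j == ordS i).
- apply: (@ordS_ind n (fun k => (k == i) || (k == ordS i)) _ i j);
    last by rewrite eqxx.
  by move=> k /orP[] /eqP ->; rewrite ?eqxx ?orbT // {1}SP ordSK eqxx.
- by move: je; rewrite ji (eqP io).
- move: ci cj => /andP[_ /eqP piL] /andP[/eqP piR _].
  by move: piR; rewrite ji piL.
Qed.

(** * Counting *)

Lemma card_one_parity_swap n : ~~ odd n ->
  #|[set pi : prefs n | one_parity true pi]| =
  #|[set pi : prefs n | one_parity false pi]|.
Proof.
move=> n_even.
(* Rotation by one seat moves every couple to a seat of the other parity. *)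
pose rot (pi : prefs n) : prefs n := [ffun i => pi (ordS i)].
have rot_inj : injective rot.
  move=> p q /ffunP pq; apply/ffunP => i.
  by have := pq (ord_pred i); rewrite !ffunE ord_predK.
have rotP b pi : one_parity b (rot pi) = one_parity (~~ b) pi.
  apply/forallP/forallP => H i.
    apply/implyP => ci; have := H (ord_pred i).
    rewrite /couple !ffunE ord_predK odd_ord_pred // => /implyP/(_ ci).
    by case: odd b {H} => [] [].
  apply/implyP; rewrite /couple !ffunE => ci; have /implyP/(_ ci) := H (ordS i).
  by rewrite odd_ordS //; case: odd b {H} => [] [].
rewrite -(card_preimset _ rot_inj); congr #|pred_of_set _|.
by apply/setP => pi; rewrite !inE rotP.
Qed.

Lemma ltn_half_even n (i : 'I_n) : ~~ odd n -> (i./2 < n./2)%N.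
Proof. by move=> n_even; have := ltn_ord i; lia. Qed.

(** With parity [true] the forbidden couples start at even seats, so the blocks [2k], [2k+1] do not
    wrap around and avoid [RL] independently. *)
Lemma card_one_parity n : ~~ odd n ->
  #|[set pi : prefs n | one_parity true pi]| = (3 ^ n./2)%N.
Proof.
move=> n_even.
pose half (i : 'I_n) : 'I_n./2 := Ordinal (ltn_half_even i n_even).
have lt0 (k : 'I_n./2) : (k.*2 < n)%N by have := ltn_ord k; lia.
have lt1 (k : 'I_n./2) : (k.*2.+1 < n)%N by have := ltn_ord k; lia.
pose e0 k := Ordinal (lt0 k); pose e1 k := Ordinal (lt1 k).
have half0 k : half (e0 k) = k by apply: val_inj; rewrite /= doubleK.
have half1 k : half (e1 k) = k by apply: val_inj; rewrite /= uphalf_double.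
have Se0 k : ordS (e0 k) = e1 k by apply: val_inj; rewrite /= modn_small.
pose join (F : {ffun 'I_n./2 -> dir * dir}) : prefs n :=
  [ffun i : 'I_n => if odd i then (F (half i)).2 else (F (half i)).1].
have join0 F k : join F (e0 k) = (F k).1 by rewrite ffunE half0 /= odd_double.
have join1 F k : join F (e1 k) = (F k).2 by rewrite ffunE half1 /= odd_double.
have join_inj : injective join.
  move=> F G eqFG; apply/ffunP => k.
  by rewrite [LHS]surjective_pairing [RHS]surjective_pairing -!join0 -!join1
    eqFG.
pose A : {set dir * dir} := [set~ (R, L)].
have -> : [set pi : prefs n | one_parity true pi]
        = join @: [set F in ffun_on A].
  apply/setP => pi; rewrite inE; apply/forallP/imsetP => [H|[F]].
    exists [ffun k => (pi (e0 k), pi (e1 k))].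
      rewrite inE; apply/ffun_onP => k; rewrite ffunE !inE.
      have := H (e0 k); rewrite /couple Se0 /= odd_double implybF.
      by rewrite xpair_eqE.
    apply/ffunP => i; rewrite !ffunE /=.
    by case: ifP => i_odd; congr (pi _); apply: val_inj => /=; lia.
  rewrite inE => /ffun_onP FA -> i; apply/implyP.
  case: (boolP (odd i)) => //= i_even.
  have -> : i = e0 (half i) by apply: val_inj => /=; lia.
  rewrite /couple Se0 join0 join1 => /andP[/eqP F1 /eqP F2].
  by have := FA (half i); rewrite !inE [F _]surjective_pairing F1 F2 eqxx.
rewrite (card_imset _ join_inj) cardsE card_ffun_on card_ord cardsC1.
rewrite card_prod (bij_eq_card (f := dir_isR)) ?card_bool //.
by exists dir_of_bool; case.
Qed.

(** No couple has both parities, so these strings have no couple at all and are constant. *)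
Lemma card_one_parity_both n : (0 < n)%N ->
  #|[set pi : prefs n | one_parity true pi && one_parity false pi]| = 2%N.
Proof.
case: n => // n _.
have -> : [set pi : prefs n.+1 | one_parity true pi && one_parity false pi]
         = [set [ffun=> L]; [ffun=> R]].
  apply/setP => pi; rewrite !inE.
  have -> : one_parity true pi && one_parity false pi = ~~ regular pi.
    rewrite regular_couple negb_exists.
    apply/andP/forallP => [[/forallP T /forallP F] i|H].
      by apply/negP => ci; move: (implyP (T i) ci) (implyP (F i) ci) => /eqP->.
    by split; apply/forallP => i; rewrite (negbTE (H i)).
  rewrite negb_and !negb_exists orbC.
  congr (_ || _); apply/forallP/eqP => [H|-> i].
  - by apply/ffunP => i; rewrite ffunE; apply/eqP; rewrite -dir_neqR.
  - by rewrite ffunE.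
  - by apply/ffunP => i; rewrite ffunE; apply/eqP; rewrite -dir_neqL.
  - by rewrite ffunE.
rewrite cards2; case: eqP => // /ffunP/(_ ord0).
by rewrite !ffunE.
Qed.


Theorem theorem2 (n : nat) (n_ge2 : (2 <= n)%N) (n_even : ~~ odd n) :
  g n = (3%:R ^+ n./2 - 1) / 2%:R ^+ n.-1.
Proof.
(* Inclusion-exclusion, where 2 is the size of the overlap; the additive form avoids subtraction in
   [nat]. *)
have cardE : (#|[set pi : prefs n | everyone_matched pi]| + 2 = 2 * 3 ^ n./2)%N.
  pose T b := [set pi : prefs n | one_parity b pi].
  have -> : [set pi : prefs n | everyone_matched pi] = T true :|: T false.
    by apply/setP => pi; rewrite !inE everyone_matchedE.
  have {1}<- : #|T true :&: T false| = 2%N.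
    rewrite -(card_one_parity_both (ltnW n_ge2)); congr #|pred_of_set _|.
    by apply/setP => pi; rewrite !inE.
  by rewrite cardsUI -card_one_parity_swap // card_one_parity // mul2n addnn.
have card_prefs : #|prefs n| = (2 * 2 ^ n.-1)%N.
  rewrite card_ffun card_ord (bij_eq_card (f := dir_isR)) ?card_bool.
    by rewrite -expnS prednK // ltnW.
  by exists dir_of_bool; case.
(* The common factor 2 comes from [cardE] above and from [2^n = 2 * 2^(n-1)] below. *)
have -> : g n = (2 * (3 ^+ n./2 - 1)) / (2 * 2 ^+ n.-1).
  rewrite /g card_prefs natrM natrX; congr (_ / _).
  apply: (addIr 2); have := congr1 (fun k => k%:R : rat) cardE.
  by rewrite natrD natrM natrX => ->; rewrite mulrBr mulr1 subrK.
by rewrite -mulf_div divff ?mul1r.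
Qed.
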